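(* Let $K$ be a field, $S=K[x_1,\dots,x_n]$, and let $I\subseteq S$ be an LP-polymatroidal ideal of type $(\boldsymbol\alpha,\boldsymbol\beta)$. Let $1\le s\le t\le n$ and $P_{[s,t]}=(x_i: s\le i\le t)$. Then $P_{[s,t]}\in\operatorname{Ass}(S/I)$ if and only if $$\beta_{s-1}<\beta_s,\quad \beta_{s-1}<\alpha_t,\quad \alpha_{t-1}<\alpha_t,\quad\text{and}\quad \alpha_i<\beta_i\ \text{ for } i=s,\dots,t-1.$$ In particular, $(x_t)\in\operatorname{Ass}(S/I)$ if and only if $\alpha_t>\beta_{t-1}$. Here $\alpha_0=\beta_0=0$.
   Context: $\mathbb Z_+$ denotes the non-negative integers, with $\mathbb Z_+^n$ ordered componentwise. LP-polymatroidal (lattice path polymatroidal) ideal: let $n,d$ be positive integers and $\boldsymbol\alpha,\boldsymbol\beta\in\mathbb Z_+^n$ with $\boldsymbol\alpha\le\boldsymbol\beta$, $\alpha_1\le\cdots\le\alpha_n=d$, $\beta_1\le\cdots\le\beta_n=d$. The LP-polymatroidal ideal of type $(\boldsymbol\alpha,\boldsymbol\beta)$ is the monomial ideal of $S$ generated by all $x_1^{u_1}\cdots x_n^{u_n}$ with $\mathbf u\in\mathbb Z_+^n$ and $\alpha_i\le u_1+\cdots+u_i\le\beta_i$ for $i=1,\dots,n$. *)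

(* Defs.v *)
From mathcomp Require Import all_boot all_order all_algebra.
From mathcomp Require Import boolp.
From mathcomp.multinomials Require Import mpoly.

Set Implicit Arguments.
Unset Strict Implicit.
Unset Printing Implicit Defensive.

Import GRing.Theory.
Local Open Scope ring_scope.

Section Ideals.
Variable R : comNzRingType.

Definition ideal_gen (G : R -> Prop) : {pred R} :=
  fun f => `[< exists (k : nat) (c g : 'I_k -> R),
                 (forall i, G (g i)) /\ f = \sum_(i < k) c i * g i >].

(* The annihilator of the class f + I in the R-module R / I. *)
Definition ann_mod (I : {pred R}) (f : R) : {pred R} :=
  [pred g | g * f \in I].

(* P \in Ass(R / I); [idealr_closed] includes properness (1 \notin P). *)
Definition associated_prime (I P : {pred R}) : Prop :=
  [/\ idealr_closed P, prime_idealr_closed P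
    & exists f : R, P =i ann_mod I f].

End Ideals.

(* 1-based access to a vector of Z_+^n, with the convention a_0 = 0:
   [entry a k] is a_k for 0 <= k <= n.  The function coercion of 'X_{1..n}
   is 0-based: [entry a k.+1] is [a j] when [j : 'I_n] has value k. *)
Definition entry n (a : 'X_{1..n}) (k : nat) : nat := nth 0%N (0%N :: a) k.

Definition lp_type (n d : nat) (alpha beta : 'X_{1..n}) : Prop :=
  [/\ (0 < n)%N /\ (0 < d)%N, (alpha <= beta)%MM,
      sorted leq alpha /\ entry alpha n = d
    & sorted leq beta /\ entry beta n = d].

Definition lp_exponent n (alpha beta u : 'X_{1..n}) : Prop :=
  forall k : nat, (1 <= k <= n)%N ->
    (entry alpha k <= \sum_(1 <= i < k.+1) entry u i <= entry beta k)%N.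

Definition lp_ideal (K : fieldType) n (alpha beta : 'X_{1..n}) :
    {pred {mpoly K[n]}} :=
  ideal_gen (fun f : {mpoly K[n]} =>
    exists2 u : 'X_{1..n}, lp_exponent alpha beta u & f = 'X_[u]).

(* The ideal (x_i : s <= i <= t), where the 1-based variable x_i is 'X_j for
   [j : 'I_n] of value i - 1. *)
Definition interval_ideal (K : fieldType) n (s t : nat) :
    {pred {mpoly K[n]}} :=
  ideal_gen (fun f : {mpoly K[n]} =>
    exists2 j : 'I_n, (s <= j.+1 <= t)%N & f = 'X_j).

Definition var_ideal (K : fieldType) n (j : 'I_n) : {pred {mpoly K[n]}} :=
  ideal_gen (fun f : {mpoly K[n]} => f = 'X_j).

Arguments lp_ideal K {n} alpha beta.
Arguments interval_ideal K n s t : clear implicits.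
Arguments var_ideal K {n} j.

(* Main.v *)
(* Since I is a monomial ideal, P_{[s,t]} is associated to S/I iff it is the
   annihilator of the class of a monomial x^w. A monomial x^w lies in I iff
   alpha_k - beta_j <= w_{j+1} + ... + w_k for all 0 <= j <= k <= n. Hence
   I : x^w = P_{[s,t]} means that, w being large outside [s,t], the only
   violated inequality is the one with (j,k) = (s-1,t), and it is violated by
   exactly 1. Adding the inequalities for (s-1,i) and (i,t) gives
   alpha_i < beta_i for s <= i < t, and the ones for (s,t) and (s-1,t-1) give
   beta_{s-1} < beta_s and alpha_{t-1} < alpha_t. Conversely, a suitable w has
   partial sums, shifted by beta_{s-1}, equal to max(alpha_k, beta_{s-1}) for
   s <= k < t and to alpha_t - 1 for k = t. *)
Require Import Defs.
From mathcomp Require Import all_boot all_order all_algebra.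
From mathcomp.multinomials Require Import mpoly.
From mathcomp Require Import boolp zify ring.

Set Implicit Arguments.
Unset Strict Implicit.
Unset Printing Implicit Defensive.

Import GRing.Theory.

(** * Monomial ideals and their membership test *)

Section MonomialIdeals.
Variables (K : fieldType) (n : nat).
Implicit Types (G : 'X_{1..n} -> Prop) (f g : {mpoly K[n]}) (m u v w : 'X_{1..n}).
Local Open Scope ring_scope.

Definition monomial_ideal G : {pred {mpoly K[n]}} :=
  ideal_gen (fun f : {mpoly K[n]} => exists2 u, G u & f = 'X_[u]).

Definition multiple_of G m := exists2 u, G u & (u <= m)%MM.

Lemma multiple_ofW G m m' :
  (m <= m')%MM -> multiple_of G m -> multiple_of G m'.
Proof. by move=> le_m [u Gu le_u]; exists u => //; apply: lepm_trans le_m. Qed.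

Lemma msuppM f g m : m \in msupp (f * g) ->
  exists m1 m2, [/\ m1 \in msupp f, m2 \in msupp g & m = (m1 + m2)%MM].
Proof. by move/msuppM_le/allpairsP => [[m1 m2] [? ? ->]]; exists m1, m2. Qed.

(** Products with x^u have only multiples of x^u in their support; conversely each term of [f]
    splits off a generator dividing it. *)
Lemma mem_monomial_ideal G f :
  reflect (forall m, m \in msupp f -> multiple_of G m) (f \in monomial_ideal G).
Proof.
apply: (iffP (asboolP _)) => [[k [c [g [Gg ->]]]]|Gf].
  elim/big_ind: _ => [m|f1 f2 IH1 IH2 m /msuppD_le|i _ m].
  - by rewrite -mpolyC0 msupp0.
  - by rewrite mem_cat => /orP[/IH1|/IH2].
  - case: (Gg i) => u Gu -> /msuppM[m1 [m2 [_]]].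
    rewrite msuppX inE => /eqP-> ->.
    by exists u => //; apply: lem_addl.
have /choice[u uP] m : exists u, m \in msupp f -> G u /\ (u <= m)%MM.
  case: (boolP (m \in msupp f)) => [/Gf[u]|_]; first by exists u.
  by exists 0%MM.
pose e i := nth 0%MM (msupp f) i.
exists (size (msupp f)), (fun i => f@_(e i) *: 'X_[e i - u (e i)]),
  (fun i => 'X_[u (e i)]); split=> [i|].
  by exists (u (e i)) => //; case: (uP (e i)) => //; apply: mem_nth.
rewrite {1}[f]mpolyE (big_nth 0%MM) big_mkord; apply: eq_bigr => i _.
by rewrite -scalerAl -mpolyXD submK //; case: (uP (e i)) => //; apply: mem_nth.
Qed.

Lemma mem_monomial_idealD G f g :
  f \in monomial_ideal G -> g \in monomial_ideal G -> f + g \in monomial_ideal G.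
Proof.
move=> /mem_monomial_ideal If /mem_monomial_ideal Ig.
apply/mem_monomial_ideal => m /msuppD_le.
by rewrite mem_cat => /orP[/If|/Ig].
Qed.

Lemma mem_monomial_idealMl G f g :
  g \in monomial_ideal G -> f * g \in monomial_ideal G.
Proof.
move=> /mem_monomial_ideal Ig; apply/mem_monomial_ideal => m.
move=> /msuppM[m1 [m2 [_ /Ig Gm2 ->]]].
by apply: multiple_ofW Gm2; apply: lem_addl.
Qed.

(** * Primes generated by variables *)

Variable A : pred 'I_n.

Definition var_gen u := exists2 j, A j & u = U_(j)%MM.

Local Notation P := (monomial_ideal var_gen).

Lemma multiple_of_var m :
  multiple_of var_gen m <-> exists2 j, A j & (m j != 0)%N.
Proof.
split=> [[_ [j Aj ->]]|[j Aj]]; rewrite -?lep1mP => le_m; first by exists j => //; rewrite -lep1mP.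
by exists U_(j)%MM => //; exists j.
Qed.

Lemma not_multiple_of_var m :
  ~ multiple_of var_gen m <-> forall j, A j -> m j = 0%N.
Proof.
rewrite multiple_of_var; split=> [NP j Aj|A0 [j Aj]].
  by apply/eqP; apply: contrapT => /negP mj; apply: NP; exists j.
by rewrite A0.
Qed.

Lemma var_ideal_idealr_closed : idealr_closed P.
Proof.
split=> [||a f g If Ig].
- by apply/mem_monomial_ideal => m; rewrite -mpolyC0 msupp0.
- apply/negP => /mem_monomial_ideal /(_ 0%MM); rewrite msupp1 inE eqxx.
  by case/(_ isT)/multiple_of_var => j _; rewrite mnm0E.
- by apply: mem_monomial_idealD => //; apply: mem_monomial_idealMl.
Qed.

(** Normal form modulo [P]: drop all terms containing a variable of [A]. *)
Lemma var_ideal_reduce f : exists2 f1 : {mpoly K[n]}, f - f1 \in P &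
  forall m, m \in msupp f1 -> ~ multiple_of var_gen m.
Proof.
pose a m := `[< multiple_of var_gen m >].
exists (\sum_(m <- msupp f | ~~ a m) f@_m *: 'X_[m]).
  rewrite {1}[f]mpolyE (bigID a) /= addrK.
  apply/mem_monomial_ideal => m /msupp_sum_le /flatten_mapP[m' ].
  rewrite mem_filter => /andP[/asboolP am' _] /msuppZ_le.
  by rewrite msuppX inE => /eqP->.
move=> m /msupp_sum_le /flatten_mapP[m'].
rewrite mem_filter => /andP[/asboolP am' _] /msuppZ_le.
by rewrite msuppX inE => /eqP->.
Qed.

(** If both normal forms are nonzero, the leading monomial of their product is the product of the
    leading ones, hence free of the variables of [A]. *)
Lemma var_ideal_prime : prime_idealr_closed P.
Proof.
move=> f g Ifg.
have [f1 If1 Nf1] := var_ideal_reduce f.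
have [g1 Ig1 Ng1] := var_ideal_reduce g.
have If1g1 : f1 * g1 \in P.
  have -> : f1 * g1 = f * g + ((- g) * (f - f1) + (- f1) * (g - g1)).
    by ring.
  by do ?[apply: mem_monomial_idealD => //]; apply: mem_monomial_idealMl.
have [f10|f1N0] := eqVneq f1 0; first by rewrite -[f]subr0 -f10 If1.
have [g10|g1N0] := eqVneq g1 0; first by rewrite -[g]subr0 -g10 Ig1 orbT.
have /mem_monomial_ideal/(_ (mlead (f1 * g1))) := If1g1.
rewrite mlead_supp ?mulf_neq0 // mleadM // => /(_ isT) /multiple_of_var[j Aj].
rewrite mnmDE; have /not_multiple_of_var-> // := Nf1 _ (mlead_supp f1N0).
have /not_multiple_of_var-> // := Ng1 _ (mlead_supp g1N0).
Qed.

(* If no monomial [w] of [f] had [I : w = P], then the product of monomials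
   [v w], one in [(I : w) \ P] for each [w], would annihilate [f] mod [I],
   although it is not in the prime ideal [P]. *)
Lemma associated_primeP G :
  associated_prime (monomial_ideal G) P <->
  exists w, (forall j, A j -> multiple_of G (U_(j) + w)) /\
    (forall v, (forall j, A j -> v j = 0%N) -> ~ multiple_of G (v + w)).
Proof.
split=> [[_ _ [f annf]]|[w [wA wNA]]].
  have fA j w : A j -> w \in msupp f -> multiple_of G (U_(j) + w).
    move=> Aj wf; have : 'X_j \in P.
      apply/mem_monomial_ideal => m; rewrite msuppX inE => /eqP->.
      by exists U_(j)%MM; [exists j|apply: lepm_refl].
    rewrite annf inE mulrC => /mem_monomial_ideal; apply.
    by rewrite mcoeff_msupp mcoeffMX -mcoeff_msupp.
  apply: contrapT => Nw.
  have /choice[v vP] w : exists v, w \in msupp f ->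
      (forall j, A j -> v j = 0%N) /\ multiple_of G (v + w).
    apply: contrapT => Nv; apply: Nw; exists w.
    have wf : w \in msupp f.
      by apply: contrapT => /negP/negPf wf; apply: Nv; exists 0%MM; rewrite wf.
    split=> [j Aj|v vA Gv]; first exact: fA.
    by apply: Nv; exists v.
  pose V := (\big[mnm_add/0%MM]_(w <- msupp f) v w)%MM.
  have : 'X_[V] \in P.
    rewrite annf inE; apply/mem_monomial_ideal => m /msuppM[? [w []]].
    rewrite msuppX inE => /eqP-> wf ->; have [_] := vP w wf.
    apply: multiple_ofW; apply/mnm_lepP => i; rewrite !mnmDE leq_add2r.
    by rewrite mnm_sumE (big_rem w) //= leq_addr.
  move/mem_monomial_ideal/(_ V); rewrite msuppX inE eqxx => /(_ isT).
  apply/not_multiple_of_var => j Aj; rewrite mnm_sumE big_seq big1 // => w wf.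
  by case: (vP w wf) => ->.
split; [exact: var_ideal_idealr_closed|exact: var_ideal_prime|].
exists 'X_[w] => g; rewrite inE.
apply/mem_monomial_ideal/mem_monomial_ideal => [gP m|gI m mg].
  move=> /msuppM[m1 [m2 [/gP/multiple_of_var[j Aj m1j]]]].
  rewrite msuppX inE => /eqP-> ->; apply: multiple_ofW (wA j Aj).
  have /mnm_lepP le_j : (U_(j) <= m1)%MM by rewrite lep1mP.
  by apply/mnm_lepP => i; rewrite !mnmDE leq_add2r.
apply: contrapT => /not_multiple_of_var/wNA; apply.
by rewrite addmC; apply: gI; rewrite mcoeff_msupp mcoeffMX -mcoeff_msupp.
Qed.

End MonomialIdeals.

(** * Exponent vectors and their partial sums *)

Section PartialSums.
Variable n : nat.
Implicit Types (a b u v w : 'X_{1..n}).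

Definition psum u k := \sum_(1 <= i < k.+1) entry u i.

Lemma psum0 u : psum u 0 = 0.
Proof. by rewrite /psum big_geq. Qed.

Lemma psumS u k : psum u k.+1 = psum u k + entry u k.+1.
Proof. by rewrite /psum big_nat_recr. Qed.

Lemma entry_ord u (j : 'I_n) : entry u j.+1 = u j.
Proof. by rewrite /entry /= (mnm_nth 0). Qed.

Lemma entryS u k (lt_kn : k < n) : entry u k.+1 = u (Ordinal lt_kn).
Proof. exact: entry_ord (Ordinal lt_kn). Qed.

Lemma entry_default u k : n <= k -> entry u k.+1 = 0.
Proof. by move=> le_nk; rewrite /entry /= nth_default ?size_tuple. Qed.

Lemma entryD u v k : entry (u + v)%MM k = entry u k + entry v k.
Proof.
case: k => [|k] //; have [lt_kn|le_nk] := ltnP k n.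
  by rewrite !entryS mnmDE.
by rewrite !entry_default.
Qed.

Lemma psumD u v k : psum (u + v)%MM k = psum u k + psum v k.
Proof.
elim: k => [|k IH]; first by rewrite !psum0.
by rewrite !psumS IH entryD addnACA.
Qed.

Lemma leq_psum u j k : j <= k -> psum u j <= psum u k.
Proof.
elim: k => [|k IH]; first by rewrite leqn0 => /eqP->.
rewrite leq_eqVlt ltnS psumS => /predU1P[->|/IH]; rewrite ?psumS //; lia.
Qed.

Lemma leq_entry a b k : (a <= b)%MM -> entry a k <= entry b k.
Proof.
move=> /mnm_lepP ab; case: k => [|k] //; have [lt_kn|le_nk] := ltnP k n.
  by rewrite !entryS.
by rewrite !entry_default.
Qed.

Lemma leq_entry_sorted a j k :
  sorted leq a -> j <= k <= n -> entry a j <= entry a k.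
Proof.
move=> a_sorted /andP[le_jk le_kn].
have s0a : sorted leq (0 :: a : seq nat) by move: a_sorted; rewrite /=; case: (a : seq nat).
by apply: (sorted_leq_nth leq_trans leqnn 0 s0a) => //;
  rewrite inE /= size_tuple ltnS // (leq_trans le_jk).
Qed.

Lemma psum1 (i : 'I_n) k : psum U_(i)%MM k = (i < k).
Proof.
elim: k => [|k IH]; first by rewrite psum0.
rewrite psumS IH; have [lt_kn|le_nk] := ltnP k n.
  rewrite entryS mnm1E -val_eqE /=; lia.
rewrite entry_default //; have := ltn_ord i; lia.
Qed.

(** Inverse of [psum] up to the constant [F 0]. Subtraction is truncated, so [F] should be
    nondecreasing. *)
Definition mnm_diff (F : nat -> nat) : 'X_{1..n} :=
  [multinom F i.+1 - F i | i < n].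

Lemma psum_diff F k : {homo F : i j / i <= j} -> k <= n ->
  psum (mnm_diff F) k + F 0 = F k.
Proof.
move=> homoF; elim: k => [|k IH] le_kn; first by rewrite psum0.
rewrite psumS entryS mnmE /=.
have := IH (ltnW le_kn); have := homoF _ _ (leqnSn k); lia.
Qed.

End PartialSums.

(** * Membership of monomials via lattice paths *)

Section LatticePaths.
Variables (n d : nat) (alpha beta : 'X_{1..n}).
Hypothesis Htype : lp_type d alpha beta.
Implicit Types (u v w : 'X_{1..n}).

Local Notation a := (entry alpha).
Local Notation b := (entry beta).
Local Notation in_lp := (multiple_of (lp_exponent alpha beta)).

Let a_leq j k : j <= k <= n -> a j <= a k.
Proof. by case: Htype => _ _ [sa _] _; apply: leq_entry_sorted. Qed.

Let b_leq j k : j <= k <= n -> b j <= b k.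
Proof. by case: Htype => _ _ _ [sb _]; apply: leq_entry_sorted. Qed.

Let ab_leq k : a k <= b k.
Proof. by case: Htype => _ ab _ _; apply: leq_entry. Qed.

Let a_leqd k : k <= n -> a k <= d.
Proof.
by case: Htype => _ _ [sa <-] _ le_kn; apply: leq_entry_sorted; rewrite ?le_kn /=.
Qed.

(* The highest lattice path below [beta] whose steps are bounded by [w]. *)
Fixpoint greedy w k :=
  if k is k'.+1 then minn (b k) (greedy w k' + entry w k) else 0.

(** [j] is the last index where [b] cuts off a full step, or the start, since b_0 = 0. *)
Lemma greedy_witness w k :
  exists2 j, j <= k & greedy w k + psum w j = b j + psum w k.
Proof.
elim: k => [|k [j le_jk Ej]]; first by exists 0.
rewrite /= psumS /minn; case: ltnP => _; first by exists k.+1; rewrite ?psumS.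
by exists j; [apply: ltnW|lia].
Qed.

Lemma greedy_leq_beta w k : greedy w k <= b k.
Proof. by case: k => //= k; apply: geq_minl. Qed.

Lemma greedy_homo w k : k < n -> greedy w k <= greedy w k.+1.
Proof.
move=> lt_kn /=; rewrite leq_min leq_addr andbT.
by apply: leq_trans (greedy_leq_beta w k) (b_leq _); rewrite leqnSn.
Qed.

(* The greedy path falls below [alpha] only if, from the last point [j] where
   it touches [beta], it cannot climb back above [alpha] by taking full steps. *)
Lemma in_lpP w :
  in_lp w <-> forall j k, j <= k <= n -> a k + psum w j <= b j + psum w k.
Proof.
split=> [[u uP le_uw] j k /andP[le_jk le_kn]|wP].
  have u_a : a k <= psum u k.
    by case: (k) le_kn => // k' ?; case/andP: (uP k'.+1 ltac:(lia)).
  have u_b : psum u j <= b j.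
    case: (j) le_jk => [|j'] ?; first by rewrite psum0.
    by case/andP: (uP j'.+1 ltac:(lia)).
  have : psum u k + psum w j <= psum w k + psum u j.
    elim: (k) le_jk => [|k' IH]; first by rewrite leqn0 => /eqP->; lia.
    rewrite leq_eqVlt ltnS => /predU1P[->|/IH]; first lia.
    rewrite !psumS; have := leq_entry k'.+1 le_uw; lia.
  lia.
(* Beyond [n] the entries of [beta] default to 0 and [greedy] would drop; freezing it at [n] keeps
   [F] monotone. *)
pose F k := greedy w (minn k n).
have homoF : {homo F : i j / i <= j}.
  apply: homo_leq => [//|y x z|i]; first exact: leq_trans.
  rewrite /F; have [lt_in|le_ni] := ltnP i n.
    by rewrite (minn_idPl lt_in) greedy_homo.
  by rewrite (minn_idPr (leqW le_ni)).
have psumF k : k <= n -> psum (mnm_diff n F) k = greedy w k.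
  by move=> le_kn; have := psum_diff homoF le_kn; rewrite /F min0n addn0 (minn_idPl le_kn).
exists (mnm_diff n F) => [k /andP[k_gt0 le_kn]|].
  rewrite -/(psum _ k) psumF // greedy_leq_beta andbT.
  have [j le_jk Ej] := greedy_witness w k.
  have := wP j k; rewrite le_jk le_kn => /(_ isT); lia.
apply/mnm_lepP => i; rewrite mnmE /F.
have lt_in := ltn_ord i.
rewrite (minn_idPl (ltnW lt_in)) (minn_idPl lt_in) -entry_ord /=; lia.
Qed.

(** * The numerical criterion for an interval [s,t] *)

Variables s t : nat.
Hypotheses (s_gt0 : 1 <= s) (le_st : s <= t) (le_tn : t <= n).

Let inside (j : 'I_n) := s <= j.+1 <= t.

(* Partial sums of an exponent vector supported outside [s,t], so large there
   that every violated inequality of [in_lpP] has s - 1 <= j < k <= t. *)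
Let outer k := d * minn k s.-1 + d * (k - t).

Let outer_homo : {homo outer : i j / i <= j}.
Proof.
by move=> i j le_ij; rewrite /outer leq_add // leq_mul2l; apply/orP; right; lia.
Qed.

(** A gain of [d] suffices for the inequality (j,k), because a_k <= d. *)
Let outer_step j k : j < k -> (j < s.-1) || (t < k) -> outer j + d <= outer k.
Proof.
move=> lt_jk /orP[lt_js|lt_tk].
  have : d * (minn j s.-1).+1 <= d * minn k s.-1.
    by rewrite leq_mul2l; apply/orP; right; lia.
  have : d * (j - t) <= d * (k - t) by rewrite leq_mul2l; apply/orP; right; lia.
  rewrite mulnS /outer; lia.
have : d * minn j s.-1 <= d * minn k s.-1.
  by rewrite leq_mul2l; apply/orP; right; lia.
have : d * (j - t).+1 <= d * (k - t) by rewrite leq_mul2l; apply/orP; right; lia.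
rewrite mulnS /outer; lia.
Qed.

Let outer_inside k : s.-1 <= k <= t -> outer k = outer s.-1.
Proof. by move=> ?; rewrite /outer; congr (d * _ + d * _); lia. Qed.

Definition lp_cond :=
  [/\ b s.-1 < b s, b s.-1 < a t, a t.-1 < a t
    & forall i, s <= i <= t.-1 -> a i < b i].

Lemma lp_cond_necessary w :
  (forall j, inside j -> in_lp (U_(j) + w)%MM) ->
  (forall v, (forall j, inside j -> v j = 0) -> ~ in_lp (v + w)%MM) ->
  lp_cond.
Proof.
move=> wA wNA.
have w1 (i : 'I_n) j k : inside i -> j <= k <= n ->
    a k + (i < j) + psum w j <= b j + (i < k) + psum w k.
  move=> /wA/in_lpP H /H; rewrite !psumD !psum1; lia.
have ltsn : s.-1 < n by lia.
have lttn : t.-1 < n by lia.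
have ins : inside (Ordinal ltsn) by rewrite /inside /=; lia.
have int : inside (Ordinal lttn) by rewrite /inside /=; lia.
have ws j k := w1 (Ordinal ltsn) j k ins.
have wt j k := w1 (Ordinal lttn) j k int.
(* Otherwise the monomial with partial sums [outer] moves [w] into the ideal. Pairs leaving [s-1,t]
   gain [d]; within it, x_s adds equally to both sides if j >= s, and x_t adds to neither if k <
   t. *)
have deficit : b s.-1 + psum w t < a t + psum w s.-1.
  rewrite ltnNge; apply/negP => no_deficit.
  apply: (wNA (mnm_diff n outer)) => [j jin|].
    move: jin; rewrite /inside mnmE => jin.
    by rewrite !outer_inside ?subnn //; lia.
  apply/in_lpP => j k jkn; rewrite !psumD.
  have [le_jk le_kn] := andP jkn.
  have := psum_diff outer_homo (leq_trans le_jk le_kn).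
  have := psum_diff outer_homo le_kn.
  have := ws j k jkn; have := wt j k jkn => /=.
  have := leq_psum w le_jk; have := a_leqd le_kn; have := ab_leq k.
  have := outer_homo le_jk.
  case: (ltnP j k) => [lt_jk|le_kj]; last first.
    have -> : k = j by lia.
    lia.
  case: (boolP ((j < s.-1) || (t < k))) => [/(outer_step lt_jk)|]; first by lia.
  rewrite negb_or -!leqNgt => /andP[sj kt].
  case: (eqVneq j s.-1) => [->|jNs]; last lia.
  case: (eqVneq k t) => [->|kNt]; last lia.
  lia.
have W j k : j <= k <= n -> psum w j <= psum w k by case/andP => ? _; apply: leq_psum.
(* Add (s-1,i) for x_t x^w to (i,t) for x_s x^w and compare with [deficit]. *)
have lt_ab i : s <= i <= t.-1 -> a i < b i.
  move=> ?; have := wt s.-1 i ltac:(lia); have := ws i t ltac:(lia) => /=; lia.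
have b_at : b s.-1 < a t by have := W s.-1 t ltac:(lia); lia.
split=> //.
  case: (eqVneq s t) => [Est|sNt].
    by apply: leq_trans b_at _; rewrite Est ab_leq.
  have := ws s t ltac:(lia); have := W s.-1 s ltac:(lia) => /=; lia.
have := wt s.-1 t.-1 ltac:(lia); have := W t.-1 t ltac:(lia) => /=; lia.
Qed.

Lemma lp_cond_sufficient : lp_cond ->
  exists w, (forall j, inside j -> in_lp (U_(j) + w)%MM) /\
  (forall v, (forall j, inside j -> v j = 0) -> ~ in_lp (v + w)%MM).
Proof.
case=> bs_lt bs_at at_lt lt_ab.
(* Inside [s,t], follow the lowest path above [alpha] that starts at height
   [b s.-1], and end one unit below [a t]. *)
pose V k := if k < t then maxn (a k) (b s.-1) else (a t).-1.
pose F k := outer k + V k.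
(* At the jump from t-1 to t this uses a_{t-1} < a_t and b_{s-1} < a_t. *)
have homoV : {homo V : i j / i <= j}.
  move=> i j le_ij; rewrite /V; have := @a_leq i t.-1; have := @a_leq i j.
  by case: (ltnP i t); case: (ltnP j t); lia.
have homoF : {homo F : i j / i <= j}.
  by move=> i j le_ij; rewrite /F leq_add ?outer_homo ?homoV.
have V_s k : k <= s.-1 -> V k = b s.-1.
  move=> le_ks; rewrite /V ifT; last lia.
  have := @a_leq k s.-1; have := ab_leq s.-1; lia.
have V_t : V t = (a t).-1 by rewrite /V ltnn.
have V_a k : k < t -> a k <= V k by rewrite /V => ->; lia.
(* The strict gap makes up for the unit missing at [t] in the inequalities (k,t). *)
have V_b k : s <= k < t -> V k < b k.
  move=> /andP[? lt_kt]; rewrite /V lt_kt.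
  have := lt_ab k; have := @b_leq s k; lia.
have psumF k : k <= n -> psum (mnm_diff n F) k + F 0 = F k by apply: psum_diff.
exists (mnm_diff n F); split=> [i iin|v v0 /in_lpP/(_ s.-1 t)].
  move: (iin); rewrite /inside => i_st.
  apply/in_lpP => j k jkn; rewrite !psumD !psum1.
  have [le_jk le_kn] := andP jkn.
  have := psumF j (leq_trans le_jk le_kn); have := psumF k le_kn; rewrite /F.
  have := homoV j k le_jk; have := outer_homo le_jk.
  have := ab_leq k; have := a_leqd le_kn.
  case: (ltnP j k) => [lt_jk|le_kj]; last first.
    have -> : k = j by lia.
    lia.
  case: (boolP ((j < s.-1) || (t < k))) => [/(outer_step lt_jk)|]; first by lia.
  rewrite negb_or -!leqNgt => /andP[sj kt].
  have -> : outer j = outer s.-1 by apply: outer_inside; lia.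
  have -> : outer k = outer s.-1 by apply: outer_inside; lia.
  (* With the endpoint values explicit, (s-1,t) falls short by 1, which the extra variable
     supplies. *)
  have -> : V k = if k == t then (a t).-1 else V k by case: eqP => // ->.
  have -> : V j = if j == s.-1 then b s.-1 else V j by case: eqP => // ->; apply: V_s.
  have := @V_a k; have := @V_b j.
  by case: eqP => [->|]; case: eqP => [->|]; lia.
rewrite !psumD.
(* [v] vanishes on [s,t], so it cannot repair the inequality (s-1,t). *)
have <- : psum v s.-1 = psum v t.
  have : forall k, s.-1 + k <= t -> psum v s.-1 = psum v (s.-1 + k).
    elim=> [|k IH] le_kt; first by rewrite addn0.
    have lt_n : s.-1 + k < n by lia.
    rewrite addnS psumS entryS v0; last by rewrite /inside /=; lia.
    by rewrite addn0 IH //; lia.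
  by move/(_ (t - s.-1)); rewrite subnKC; [apply|]; lia.
have := psumF s.-1; have := psumF t.
rewrite /F V_t (V_s s.-1) // (@outer_inside t); lia.
Qed.

Lemma lp_condP : lp_cond <->
  exists w, (forall j, inside j -> in_lp (U_(j) + w)%MM) /\
  (forall v, (forall j, inside j -> v j = 0) -> ~ in_lp (v + w)%MM).
Proof.
by split=> [/lp_cond_sufficient//|[w [wA wNA]]]; apply: lp_cond_necessary wA wNA.
Qed.

End LatticePaths.

(** * Interval ideals and the final equivalences *)

Lemma interval_idealE (K : fieldType) n s t :
  interval_ideal K n s t =
  monomial_ideal (var_gen (fun j : 'I_n => s <= j.+1 <= t)).
Proof.
congr ideal_gen; apply/funext => f; apply/propext.
by split=> [[j jst ->]|[_ [j jst ->] ->]]; [exists U_(j)%MM => //|]; exists j.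
Qed.

Lemma var_idealE (K : fieldType) n (j : 'I_n) :
  var_ideal K j = interval_ideal K n j.+1 j.+1.
Proof.
congr ideal_gen; apply/funext => f; apply/propext.
split=> [->|[i ij ->]]; first by exists j; rewrite ?leqnn.
by congr 'X__; apply/val_inj => /=; lia.
Qed.

(* In the second part, t = j.+1. *)
Theorem proposition4p7 (K : fieldType) (n d : nat) (alpha beta : 'X_{1..n})
    (Htype : lp_type d alpha beta) :
  (forall s t : nat, (1 <= s)%N -> (s <= t)%N -> (t <= n)%N ->
     (associated_prime (lp_ideal K alpha beta) (interval_ideal K n s t) <->
      [/\ (entry beta s.-1 < entry beta s)%N,
          (entry beta s.-1 < entry alpha t)%N,
          (entry alpha t.-1 < entry alpha t)%N
        & forall i : nat, (s <= i <= t.-1)%N ->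
            (entry alpha i < entry beta i)%N]))
  /\
  (forall j : 'I_n,
     associated_prime (lp_ideal K alpha beta) (var_ideal K j) <->
     (entry beta j < entry alpha j.+1)%N).
Proof.
have main s t : 1 <= s -> s <= t -> t <= n ->
    associated_prime (lp_ideal K alpha beta) (interval_ideal K n s t) <->
    lp_cond alpha beta s t.
  move=> s1 st tn; rewrite interval_idealE (lp_condP Htype s1 st tn).
  exact: associated_primeP.
split=> // j; rewrite var_idealE main //=; split=> [[]//|lt_ba].
have [_ ab [sa _] [sb _]] := Htype; have lt_jn := ltn_ord j.
have ab' := leq_entry _ ab.
(* Here s = t = j+1: a_j <= b_j < a_{j+1} <= b_{j+1}, and the range of [i] is empty. *)
split=> //=; [exact: leq_trans (ab' _)|exact: leq_ltn_trans lt_ba|move=> i; lia].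
Qed.
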